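(* For any $\mathcal{M}_\gamma^{\kappa_1,\kappa_2}\in\Sigma_2$, the following are equivalent: (1) $\mathcal{M}_\gamma^{\kappa_1,\kappa_2}\in\Sigma_2^0$. (2) The six lines $L_6,L_7,L_8,L_{10},L_{11},L_{13}$ are tangent to a smooth conic. (3) The six triple points $P_{1,8,10}$, $P_{1,11,12}$, $P_{2,8,9}$, $P_{2,11,13}$, $P_{3,9,10}$ and $P_{3,12,13}$ are contained in a smooth conic. (4) The three triple points $P_{1,11,12}$, $P_{2,8,9}$ and $P_{3,4,5}$ are aligned.
   Context: For $\kappa_1,\kappa_2,\gamma\in\mathbb{C}^*$ with $\kappa_1^2=\kappa_2^2=\gamma$, $\mathcal{M}_\gamma^{\kappa_1,\kappa_2}$ is the set of the following lines in $\mathbb{CP}^2$: $L_1:y=0$, $L_2:x=0$, $L_3:z=0$, $L_4:x+y+z=0$, $L_5:\gamma x+\gamma y+z=0$, $L_6:x+\gamma y+z=0$, $L_7:\gamma x+y+z=0$, $L_8:\kappa_1^{-1}x+\kappa_1y+z=0$, $L_9:x+\kappa_1y+z=0$, $L_{10}:\kappa_1^{-1}x+y+z=0$, $L_{11}:\kappa_2x+\kappa_2^{-1}y+z=0$, $L_{12}:\kappa_2x+y+z=0$, $L_{13}:x+\kappa_2^{-1}y+z=0$. We write $\mathcal{M}_\gamma^{\kappa_1,\kappa_2}\in\Sigma_2$ when these are 13 distinct lines whose maximal sets of (at least three) concurrent lines are exactly, in terms of indices, $\{1,4,6,9,13\}$, $\{1,5,7\}$, $\{1,8,10\}$, $\{1,11,12\}$,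 $\{2,4,7,10,12\}$, $\{2,5,6\}$, $\{2,8,9\}$, $\{2,11,13\}$, $\{3,4,5\}$, $\{3,6,8\}$, $\{3,7,11\}$, $\{3,9,10\}$, $\{3,12,13\}$. $\Sigma_2$ is the moduli space (modulo $\mathrm{PGL}_3(\mathbb{C})$) of arrangements with this combinatorics; it has two connected components, and $\Sigma_2^0$ is the one consisting of the arrangements $\mathcal{M}_\gamma^{\kappa_1,\kappa_2}\in\Sigma_2$ with $\kappa_1=\kappa_2$ (the other one being given by $\kappa_1=-\kappa_2$). $P_{i_1,\dots,i_k}$ denotes the singular point of the arrangement at which $L_{i_1},\dots,L_{i_k}$ meet. *)

(* Defs.v *)
From HB Require Import structures.
From mathcomp Require Import all_boot all_order all_algebra.
From mathcomp Require Import reals complex.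

Set Implicit Arguments.
Unset Strict Implicit.
Unset Printing Implicit Defensive.

Import Order.TTheory GRing.Theory Num.Theory.
Local Open Scope ring_scope.

(* The complex numbers are R[i] for a complete archimedean real field R.     *)
(* Points of CP^2 are given by nonzero columns of homogeneous coordinates,   *)
(* lines by nonzero rows of coefficients, both up to a nonzero scalar; the   *)
(* point p lies on the line l when l *m p = 0.                               *)

Definition on_line (R : realType) (l : 'rV[R[i]]_3) (p : 'cV[R[i]]_3) : bool :=
  l *m p == 0.

Definition same_line (R : realType) (l m : 'rV[R[i]]_3) : Prop :=
  exists2 c : R[i], c != 0 & l = c *: m.

(* The line labelled k (1 <= k <= 13) has index k - 1 in 'I_13. *)
Definition arrangement (R : realType) := 'I_13 -> 'rV[R[i]]_3.

Definition labels (s : seq nat) : {set 'I_13} := [set i : 'I_13 | i.+1 \in s].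

Definition concurrent (R : realType) (A : arrangement R) (I : {set 'I_13}) :
    Prop :=
  exists2 p : 'cV[R[i]]_3, p != 0 & forall i, i \in I -> on_line (A i) p.

Definition maximal_concurrent (R : realType) (A : arrangement R)
    (I : {set 'I_13}) : Prop :=
  [/\ (3 <= #|I|)%N, concurrent A I
    & forall J : {set 'I_13}, I \subset J -> concurrent A J -> J = I].

Definition combinatorics2 : seq {set 'I_13} :=
  [seq labels s | s <- [:: [:: 1; 4; 6; 9; 13]; [:: 1; 5; 7]; [:: 1; 8; 10];
     [:: 1; 11; 12]; [:: 2; 4; 7; 10; 12]; [:: 2; 5; 6]; [:: 2; 8; 9];
     [:: 2; 11; 13]; [:: 3; 4; 5]; [:: 3; 6; 8]; [:: 3; 7; 11];
     [:: 3; 9; 10]; [:: 3; 12; 13]]%N].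

(* Being in Sigma2 or Sigma20 is invariant under PGL_3(C): these predicates  *)
(* on arrangements stand for subsets of the moduli space.                    *)
Definition Sigma2 (R : realType) (A : arrangement R) : Prop :=
  [/\ forall i, A i != 0,
      forall i j, same_line (A i) (A j) -> i = j
    & forall I : {set 'I_13}, maximal_concurrent A I <-> I \in combinatorics2].

(* A row l is sent to l *m g when the points are transformed by g^-1. *)
Definition proj_equiv (R : realType) (A B : arrangement R) : Prop :=
  exists2 g : 'M[R[i]]_3, g \in unitmx &
    forall i, same_line (B i) (A i *m g).

Definition line (R : realType) (a b c : R[i]) : 'rV[R[i]]_3 :=
  \row_(j < 3) [:: a; b; c]`_j.

Definition M (R : realType) (gamma k1 k2 : R[i]) : arrangement R := fun i =>
  [:: line 0 1 0;
      line 1 0 0;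
      line 0 0 1;
      line 1 1 1;
      line gamma gamma 1;
      line 1 gamma 1;
      line gamma 1 1;
      line k1^-1 k1 1;
      line 1 k1 1;
      line k1^-1 1 1;
      line k2 k2^-1 1;
      line k2 1 1;
      line 1 k2^-1 1]`_i.

(* The component of Sigma2 made of the classes of the M gamma k1 k2 with     *)
(* k1 = k2.                                                                  *)
Definition Sigma20 (R : realType) (A : arrangement R) : Prop :=
  exists gamma k : R[i],
    [/\ gamma != 0, k != 0, k ^+ 2 = gamma, Sigma2 (M gamma k k)
      & proj_equiv A (M gamma k k)].

(* The conic of a symmetric matrix Q is the zero locus of p^T Q p; the       *)
(* gradient of this quadratic form at p is 2 p^T Q.                          *)
Definition on_conic (R : realType) (Q : 'M[R[i]]_3) (p : 'cV[R[i]]_3) : bool :=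
  p^T *m Q *m p == 0.

Definition conic_gradient (R : realType) (Q : 'M[R[i]]_3) (p : 'cV[R[i]]_3) :
    'rV[R[i]]_3 := 2%:R *: (p^T *m Q).

Definition smooth_conic (R : realType) (Q : 'M[R[i]]_3) : Prop :=
  Q^T = Q /\
  forall p : 'cV[R[i]]_3, p != 0 -> on_conic Q p -> conic_gradient Q p != 0.

Definition tangent_to_conic (R : realType) (Q : 'M[R[i]]_3)
    (l : 'rV[R[i]]_3) : Prop :=
  exists p : 'cV[R[i]]_3,
    [/\ p != 0, on_conic Q p & same_line l (conic_gradient Q p)].

(* p represents the point P_s where the lines with labels in s meet. *)
Definition meet_at (R : realType) (A : arrangement R) (s : seq nat)
    (p : 'cV[R[i]]_3) : Prop :=
  p != 0 /\ forall i, i \in labels s -> on_line (A i) p.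

(* Main.v *)
Require Import Defs.
From HB Require Import structures.
From mathcomp Require Import all_boot all_order all_algebra.
From mathcomp Require Import boolp reals complex ring.

Import Order.TTheory GRing.Theory Num.Theory.
Local Open Scope ring_scope.

Set Implicit Arguments.
Unset Strict Implicit.

(* Every condition amounts to [k1 = k2]. The determinant of the three points of
   (4) is [k2 - k1] up to sign; alignment is projectively invariant, so (1)
   implies (4). For (3), by Carnot's theorem on the triangle [L_1 L_2 L_3], the
   six points lie on a conic exactly when [k1 = k2]. For (2), the six lines are
   tangent to a smooth conic when they lie, as points of the dual plane, on its
   dual conic; by Brianchon's theorem for the hexagon 6-13-11-7-10-8 this forces
   [k1 = k2], which is proved here by eliminating the coefficients of the dual
   conic when [k2 = - k1]. Conversely, for [k1 = k2] both conics are explicit,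
   and their determinants are products of quantities that vanish only when two
   lines coincide or three lines have an extra common point. *)

Lemma eq_of_combination (V : zmodType) (x y z : V) : z = 0 -> x - y = z -> x = y.
Proof. by move=> -> /eqP; rewrite subr_eq0 => /eqP. Qed.

(* Used with [eq_of_combination] and a final [erefl], builds a proof that a
   linear combination of known zeros vanishes, for [ring] to compare with
   [x - y]. *)
Lemma combination_cons (F : pzRingType) (a x y : F) :
  x = 0 -> y = 0 -> a * x + y = 0.
Proof. by move=> -> ->; rewrite mulr0 addr0. Qed.

Local Notation simp := Monoid.simpm.
Local Notation lab k := (@Ordinal 13 k.-1 isT).

(** * Points, lines, conics and dual conics in homogeneous coordinates *)

Section HomogeneousCoordinates.
Variable R : realType.
Implicit Types (a b c d e f x y z t : R[i]) (Q S : 'M[R[i]]_3).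

Definition symmx a b c d e f : 'M[R[i]]_3 :=
  \matrix_(i < 3, j < 3)
    (nth [::] [:: [:: a; d; e]; [:: d; b; f]; [:: e; f; c]] i)`_j.

Lemma rV3P (l : 'rV[R[i]]_3) : exists x y z, l = line x y z.
Proof.
exists (l 0 0), (l 0 (inord 1)), (l 0 (inord 2)).
apply/rowP => -[[|[|[|m]]] hm] //; rewrite mxE /=; congr (l _ _);
  by apply/val_inj; rewrite /= ?inordK.
Qed.

Lemma cV3P (p : 'cV[R[i]]_3) : exists x y z, p = (line x y z)^T.
Proof. by have [x [y [z e]]] := rV3P p^T; exists x, y, z; rewrite -e trmxK. Qed.

Lemma symmxP Q : Q^T = Q -> exists a b c d e f, Q = symmx a b c d e f.
Proof.
move=> symQ; pose q i j := Q (inord i) (inord j).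
have qC i j : q i j = q j i by rewrite /q -{1}symQ mxE.
exists (q 0 0)%N, (q 1 1)%N, (q 2 2)%N, (q 0 1)%N, (q 0 2)%N, (q 1 2)%N.
have QE i j : Q i j = q i j by rewrite /q !inord_val.
by apply/matrixP => -[[|[|[|m]]] hm] // [[|[|[|n]]] hn] //;
  rewrite QE mxE //= qC.
Qed.

Lemma line_eq0 x y z : (line x y z == 0) = [&& x == 0, y == 0 & z == 0].
Proof.
apply/eqP/and3P => [/rowP l0 | [/eqP-> /eqP-> /eqP->]].
  have := (l0 0, l0 1, l0 (inord 2)); rewrite !mxE /= inordK // => -[[]] /=.
  by move=> -> -> ->.
by apply/rowP => -[[|[|[|m]]] hm] //; rewrite !mxE.
Qed.

Lemma scale_line t x y z : t *: line x y z = line (t * x) (t * y) (t * z).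
Proof. by apply/rowP => -[[|[|[|m]]] hm] //; rewrite !mxE. Qed.

Lemma tr_line_eq0 x y z :
  ((line x y z)^T == 0) = [&& x == 0, y == 0 & z == 0].
Proof. by rewrite -line_eq0 -(inj_eq trmx_inj) trmxK trmx0. Qed.

Lemma mx11_eq0 (A : 'M[R[i]]_1) : (A == 0) = (A 0 0 == 0).
Proof.
apply/eqP/eqP => [-> | A0]; first by rewrite mxE.
by rewrite [A]mx11_scalar A0 raddf0.
Qed.

Lemma on_lineE a b c x y z :
  on_line (line a b c) (line x y z)^T = (a * x + b * y + c * z == 0).
Proof.
rewrite /on_line mx11_eq0 !mxE.
by rewrite !big_ord_recl big_ord0 /= !mxE /= addr0 addrA.
Qed.

Lemma symmx_formE a b c d e f x y z :
  (line x y z *m symmx a b c d e f *m (line x y z)^T == 0) =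
  (a * x ^+ 2 + b * y ^+ 2 + c * z ^+ 2
    + 2%:R * (d * x * y + e * x * z + f * y * z) == 0).
Proof.
rewrite mx11_eq0 !mxE.
rewrite !big_ord_recl big_ord0 /= !mxE /=.
rewrite !big_ord_recl !big_ord0 /= !mxE /=.
by congr (_ == _); ring.
Qed.

Lemma tr_symmx a b c d e f : (symmx a b c d e f)^T = symmx a b c d e f.
Proof.
by apply/matrixP => -[[|[|[|m]]] hm] // [[|[|[|n]]] hn] //; rewrite !mxE.
Qed.

Lemma unitmx_symmx a b c d e f :
    a * b * c + 2%:R * d * e * f - a * f ^+ 2 - b * e ^+ 2 - c * d ^+ 2 != 0 ->
  symmx a b c d e f \in unitmx.
Proof.
set D := (X in X != 0) => D0.
(* [C] is the adjugate of the symmetric matrix and [D] its determinant. *)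
pose C := symmx (b * c - f ^+ 2) (a * c - e ^+ 2) (a * b - d ^+ 2)
                (e * f - c * d) (d * f - b * e) (d * e - a * f).
suff SC : symmx a b c d e f *m C = D%:M.
  apply: (proj1 (mulmx1_unit (B := D^-1 *: C) _)).
  by rewrite -scalemxAr SC scale_scalar_mx mulVf.
apply/matrixP => -[[|[|[|m]]] hm] // [[|[|[|n]]] hn] //;
  rewrite !mxE !big_ord_recl big_ord0 !mxE /= /D ?mulr1n ?mulr0n; ring.
Qed.

(** This lemma and the next two parametrize the meets with [L_1], [L_2] and [L_3], the axes that
    carry all the triple points of (3) and (4). *)
Lemma meet_axis1 a b p : on_line (line 0 1 0) p -> on_line (line a b 1) p ->
  exists t, p = t *: (line 1 0 (- a))^T.
Proof.
have [x [y [z ->]]] := cV3P p.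
rewrite !on_lineE !simp => /eqP->; rewrite ?simp addr_eq0 => /eqP e.
exists x; rewrite -linearZ scale_line; congr (line _ _ _)^T; ring: e.
Qed.

Lemma meet_axis2 a b p : on_line (line 1 0 0) p -> on_line (line a b 1) p ->
  exists t, p = t *: (line 0 1 (- b))^T.
Proof.
have [x [y [z ->]]] := cV3P p.
rewrite !on_lineE !simp => /eqP->; rewrite ?simp addr_eq0 => /eqP e.
exists y; rewrite -linearZ scale_line; congr (line _ _ _)^T; ring: e.
Qed.

Lemma meet_axis3 a b c p : b != 0 ->
    on_line (line 0 0 1) p -> on_line (line a b c) p ->
  exists t, p = t *: (line b (- a) 0)^T.
Proof.
move=> b0; have [x [y [z ->]]] := cV3P p.
rewrite !on_lineE !simp => /eqP->; rewrite ?simp addr_eq0 => /eqP e.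
exists (x / b); rewrite -linearZ scale_line; congr (line _ _ _)^T; by field: e.
Qed.

Lemma symmx0 : symmx 0 0 0 0 0 0 = 0.
Proof.
by apply/matrixP => -[[|[|[|m]]] hm] // [[|[|[|n]]] hn] //; rewrite !mxE.
Qed.

Lemma nonunit_mx0 : (0 : 'M[R[i]]_3) \notin unitmx.
Proof. by rewrite unitmxE det0 unitr0. Qed.

Lemma on_lineZ t (l : 'rV[R[i]]_3) p :
  t != 0 -> on_line l (t *: p) = on_line l p.
Proof. by move=> t0; rewrite /on_line -scalemxAr scaler_eq0 (negPf t0). Qed.

Lemma on_conicZ t Q p : t != 0 -> on_conic Q (t *: p) = on_conic Q p.
Proof.
move=> t0; rewrite /on_conic -scalemxAr [(t *: p)^T]linearZ /= -!scalemxAl.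
by rewrite !scaler_eq0 (negPf t0).
Qed.

(** A kernel vector of [Q] would be a point of the conic with zero gradient. Conversely, [p^T *m Q]
    vanishes only for [p = 0] when [Q] is invertible. *)
Lemma smooth_conicP Q : smooth_conic Q <-> Q^T = Q /\ Q \in unitmx.
Proof.
split=> [[symQ smQ] | [symQ uQ]]; split=> //.
  rewrite unitmxE unitfE; apply/negP => /det0P[v v0 vQ].
  have /smQ : v^T != 0 by rewrite -(inj_eq trmx_inj) trmxK trmx0.
  rewrite /on_conic /conic_gradient trmxK vQ mul0mx scaler0 !eqxx => /(_ isT).
  by [].
move=> p p0 _; rewrite scaler_eq0 pnatr_eq0 /=.
apply: contra_neq p0 => pQ; apply: trmx_inj.
by rewrite -(mulmxK uQ p^T) pQ mul0mx trmx0.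
Qed.

(* [invmx Q] is the matrix of the dual conic. *)
Lemma tangent_to_conicP Q (l : 'rV[R[i]]_3) : smooth_conic Q -> l != 0 ->
  tangent_to_conic Q l <-> l *m invmx Q *m l^T == 0.
Proof.
case/smooth_conicP=> symQ uQ l0; split.
  case=> p [p0 /eqP pQ [c c0 ->]]; rewrite /conic_gradient scalerA.
  rewrite linearZ /= trmx_mul trmxK symQ -!scalemxAl -scalemxAr.
  by rewrite mulmxK // mulmxA pQ !scaler0.
(* The point of contact is the pole of [l]; the scalar [2%:R^-1] absorbs the factor 2 of the
   gradient. *)
move/eqP=> lQ; exists (l *m invmx Q)^T.
rewrite /on_conic /conic_gradient trmxK mulmxKV //; split.
- apply: contra_neq l0 => h; apply: trmx_inj.
  rewrite -(mulmxKV uQ l) trmx_mul h mulmx0 trmx0 //.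
- by rewrite trmx_mul trmx_inv symQ mulmxA lQ.
- exists 2%:R^-1; first by rewrite invr_eq0 pnatr_eq0.
  by rewrite scalerA mulVf ?scale1r // pnatr_eq0.
Qed.

(** Shaped so that condition (4) is an instance of it by unfolding. *)
Definition aligned (A : arrangement R) (ss : seq (seq nat)) : Prop :=
  exists l : 'rV[R[i]]_3, l != 0 /\
    forall s, s \in ss -> exists2 p, meet_at A s p & on_line l p.

(** Multiplication by [g] carries the meeting points of [B] to those of [A], and right
    multiplication by [invmx g] moves the line along with them. *)
Lemma proj_equiv_aligned A B ss :
  proj_equiv A B -> aligned B ss -> aligned A ss.
Proof.
case=> g gU AB [l [l0 lp]]; exists (l *m invmx g); split.
  by apply: contra_neq l0 => h; rewrite -(mulmxKV gU l) h mul0mx.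
move=> s /lp[p [p0 Bp] ll]; exists (g *m p).
  split; first by apply: contra_neq p0 => h; rewrite -(mulKmx gU p) h mulmx0.
  move=> i /Bp; have [c c0 ->] := AB i.
  by rewrite /on_line -scalemxAl scaler_eq0 (negPf c0) mulmxA.
by rewrite /on_line mulmxA mulmxKV.
Qed.

End HomogeneousCoordinates.

(** * Concurrence in a realization of the combinatorics *)

Section Realization.
Variable R : realType.
Implicit Types A : arrangement R.

Lemma Sigma2_neq A i j : Sigma2 A -> i != j -> A i != A j.
Proof.
case=> _ inj _; apply: contra_neq => Aij; apply: inj.
by exists 1; rewrite ?oner_neq0 ?scale1r.
Qed.

(** A concurrent triple extends to a maximal concurrent set, which must be listed; this rules out
    unlisted concurrences. The boolean [conc] makes [maxset] applicable. *)
Lemma Sigma2_concurrent3 A i j k p : Sigma2 A -> uniq [:: i; j; k] -> p != 0 ->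
    on_line (A i) p -> on_line (A j) p -> on_line (A k) p ->
  has (fun J : {set 'I_13} => [&& i \in J, j \in J & k \in J]) combinatorics2.
Proof.
move=> [_ _ combA] uijk p0 Ai Aj Ak.
pose conc J := `[< concurrent A J >].
have cI : conc [set i; j; k].
  by apply/asboolP; exists p => [//|m];
    rewrite !in_setU !in_set1 => /orP[/orP[]|] /eqP->.
have [J /maxsetP[/asboolP cJ maxJ] IJ] := maxset_exists cI.
apply/hasP; exists J; last by rewrite !(subsetP IJ) // !inE eqxx ?orbT.
apply/combA; split=> // [|K JK cK].
  apply: leq_trans (subset_leq_card IJ); move: uijk; rewrite /= !inE !andbT.
  case/andP=> /norP[ij ik] jk.
  by rewrite setUC cardsU1 cards2 !inE negb_or ![k == _]eq_sym ik jk ij.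
by apply: maxJ => //; apply/asboolP.
Qed.

(** Representatives, written as rows, of the six points of (3) in order, then of [P_{3,4,5}] for
    (4). *)
Definition triple_points k1 k2 : seq (seq nat * 'rV[R[i]]_3) :=
  [:: ([:: 1; 8; 10]%N, line 1 0 (- k1^-1));
      ([:: 1; 11; 12]%N, line 1 0 (- k2));
      ([:: 2; 8; 9]%N, line 0 1 (- k1));
      ([:: 2; 11; 13]%N, line 0 1 (- k2^-1));
      ([:: 3; 9; 10]%N, line k1 (-1) 0);
      ([:: 3; 12; 13]%N, line 1 (- k2) 0);
      ([:: 3; 4; 5]%N, line 1 (-1) 0)].

(** * Triple points on the coordinate axes; alignment and Carnot's theorem *)

Section TriplePoints.
Variables gamma k1 k2 : R[i].
Hypotheses (k1_neq0 : k1 != 0) (k2_neq0 : k2 != 0).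

(** The axis and one further line already determine the point up to a scalar; conversely, all three
    incidences are checked on [v]. *)
Lemma meet_atP s v p : (s, v) \in triple_points k1 k2 ->
  meet_at (M gamma k1 k2) s p <-> exists2 t, t != 0 & p = t *: v^T.
Proof.
rewrite !inE => sv; split.
  case=> p0 ps; suff [t e] : exists t, p = t *: v^T.
    by exists t => //; apply: contraNneq p0 => t0; rewrite e t0 scale0r.
  move: ps; do 6?case/orP: sv => sv; case/eqP: sv => -> -> ps.
  - by apply: (meet_axis1 (b := k1) (ps (lab 1) _) (ps (lab 8) _)); rewrite inE.
  - by apply: (meet_axis1 (b := k2^-1) (ps (lab 1) _) (ps (lab 11) _));
      rewrite inE.
  - by apply: (meet_axis2 (a := k1^-1) (ps (lab 2) _) (ps (lab 8) _));
      rewrite inE.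
  - by apply: (meet_axis2 (a := k2) (ps (lab 2) _) (ps (lab 11) _));
      rewrite inE.
  - by apply: (meet_axis3 k1_neq0 (ps (lab 3) _) (ps (lab 9) _)); rewrite inE.
  - by apply: (meet_axis3 (oner_neq0 _) (ps (lab 3) _) (ps (lab 12) _));
      rewrite inE.
  - by apply: (meet_axis3 (oner_neq0 _) (ps (lab 3) _) (ps (lab 4) _));
      rewrite inE.
case=> t [t0 ->].
have [v0 vs] : v != 0 /\ forall i, i \in labels s ->
    on_line (M gamma k1 k2 i) v^T.
  do 6?case/orP: sv => sv; case/eqP: sv => -> ->;
  rewrite line_eq0 ?oner_eq0 ?oppr_eq0 ?oner_eq0 ?andbF; split=> [//|[m hm]];
  rewrite inE /= !inE => /or3P[] /eqP[e]; subst m; rewrite /M /= on_lineE;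
  by apply/eqP; field; rewrite ?k1_neq0 ?k2_neq0.
split; last by move=> i /vs; rewrite on_lineZ.
by rewrite scaler_eq0 (negPf t0) -(inj_eq trmx_inj) trmxK trmx0.
Qed.

Lemma meet_on_conicP Q s v : (s, v) \in triple_points k1 k2 ->
  (exists2 p, meet_at (M gamma k1 k2) s p & on_conic Q p) <-> on_conic Q v^T.
Proof.
move=> sv; split=> [[p /(meet_atP _ sv)[t [t0 ->]]]|vQ].
  by rewrite on_conicZ.
exists v^T => //; apply/(meet_atP _ sv).
by exists 1; rewrite ?oner_neq0 ?scale1r.
Qed.

Lemma meet_on_lineP l s v : (s, v) \in triple_points k1 k2 ->
  (exists2 p, meet_at (M gamma k1 k2) s p & on_line l p) <-> on_line l v^T.
Proof.
move=> sv; split=> [[p /(meet_atP _ sv)[t [t0 ->]]]|vl].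
  by rewrite on_lineZ.
exists v^T => //; apply/(meet_atP _ sv).
by exists 1; rewrite ?oner_neq0 ?scale1r.
Qed.

Lemma mem_triple n : (n < 7)%N ->
  nth ([::], 0) (triple_points k1 k2) n \in triple_points k1 k2.
Proof. by move=> n7; rewrite mem_nth. Qed.

Lemma aligned_triple_pointsP :
  aligned (M gamma k1 k2) [:: [:: 1; 11; 12]; [:: 2; 8; 9]; [:: 3; 4; 5]]%N <->
  k1 = k2.
Proof.
have sv1 : (_, line 1 0 (- k2)) \in _ := @mem_triple 1 isT.
have sv2 : (_, line 0 1 (- k1)) \in _ := @mem_triple 2 isT.
have sv3 : (_, line 1 (-1) 0) \in _ := @mem_triple 6 isT.
split=> [[l [l0 hl]] | k12].
  have /(meet_on_lineP _ sv1) := hl [:: 1; 11; 12]%N isT.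
  have /(meet_on_lineP _ sv2) := hl [:: 2; 8; 9]%N isT.
  have /(meet_on_lineP _ sv3) := hl [:: 3; 4; 5]%N isT.
  have [a [b [c el]]] := rV3P l; rewrite {}el {hl} in l0 *.
  rewrite !on_lineE => /eqP e3 /eqP e2 /eqP e1.
  apply: contraNeq l0; rewrite -subr_eq0 => k12.
  (* [e1 - e2 - e3] reads [(k1 - k2) * c = 0]; then [e1] and [e2] give [a = b = 0]. *)
  have c0 : c = 0.
    apply: (mulfI k12); rewrite mulr0.
    by apply: eq_of_combination (combination_cons 1 e1
      (combination_cons (-1) e2 (combination_cons (-1) e3 erefl))) _; ring.
  move: e1 e2; rewrite line_eq0 c0 !simp => -> ->.
  by rewrite !eqxx.
exists (line k2 k2 1); rewrite line_eq0 oner_eq0 !andbF; split=> // s.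
rewrite !inE => /or3P[] /eqP->.
- by apply/(meet_on_lineP _ sv1); rewrite on_lineE; apply/eqP; ring.
- by apply/(meet_on_lineP _ sv2); rewrite on_lineE k12; apply/eqP; ring.
- by apply/(meet_on_lineP _ sv3); rewrite on_lineE; apply/eqP; ring.
Qed.

Definition triple_labels : seq (seq nat) :=
  [:: [:: 1; 8; 10]; [:: 1; 11; 12]; [:: 2; 8; 9]; [:: 2; 11; 13];
      [:: 3; 9; 10]; [:: 3; 12; 13]]%N.

(* Carnot's theorem for the triangle of the coordinate axes: on each axis, the
   product of the two roots of the restriction of the conic gives the ratio of
   two diagonal coefficients. *)
Lemma conic_triple_points_eq Q : k1 * k2 != 1 -> smooth_conic Q ->
    (forall s, s \in triple_labels ->
       exists2 p, meet_at (M gamma k1 k2) s p & on_conic Q p) ->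
  k1 = k2.
Proof.
rewrite -subr_eq0 => k12 /smooth_conicP[symQ uQ] hQ.
have [a [b [c [d [e [f eQ]]]]]] := symmxP symQ; rewrite {}eQ {symQ} in uQ hQ.
have onQ s x y z : s \in triple_labels ->
    (s, line x y z) \in triple_points k1 k2 ->
    a * x ^+ 2 + b * y ^+ 2 + c * z ^+ 2
      + 2%:R * (d * x * y + e * x * z + f * y * z) = 0.
  move=> /hQ hs /meet_on_conicP onP; have := (onP _).1 hs.
  by rewrite /on_conic trmxK symmx_formE => /eqP.
have e1 : _ = 0 := onQ [:: 1; 8; 10]%N 1 0 (- k1^-1) isT (@mem_triple 0 isT).
have e2 : _ = 0 := onQ [:: 1; 11; 12]%N 1 0 (- k2) isT (@mem_triple 1 isT).
have e3 : _ = 0 := onQ [:: 2; 8; 9]%N 0 1 (- k1) isT (@mem_triple 2 isT).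
have e4 : _ = 0 := onQ [:: 2; 11; 13]%N 0 1 (- k2^-1) isT (@mem_triple 3 isT).
have e5 : _ = 0 := onQ [:: 3; 9; 10]%N k1 (-1) 0 isT (@mem_triple 4 isT).
have e6 : _ = 0 := onQ [:: 3; 12; 13]%N 1 (- k2) 0 isT (@mem_triple 5 isT).
(* The factor [k1 * k2 - 1] cancelled in the next three relations is nonzero exactly when the two
   points on each axis are distinct. *)
have ac : a * k1 = c * k2.
  apply: (mulfI k12).
  apply: eq_of_combination (combination_cons (k1 ^+ 2 * k2) e1
      (combination_cons (- k1) e2 erefl)) _; by field.
have bc : b * k2 = c * k1.
  apply: (mulfI k12).
  apply: eq_of_combination (combination_cons (- k2) e3
      (combination_cons (k1 * k2 ^+ 2) e4 erefl)) _; by field.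
have ab : a * k1 = b * k2.
  apply: (mulfI k12).
  apply: eq_of_combination (combination_cons k2 e5
      (combination_cons (- k1) e6 erefl)) _; by field.
apply: contraTeq uQ; rewrite -subr_eq0 => neq_k12.
(* Going around the triangle, [c * k1 = b * k2 = a * k1 = c * k2], so [c = 0] when [k1 != k2]; all
   other coefficients then vanish, and [Q] is not invertible. *)
have c0 : c = 0.
  apply: (mulIf neq_k12); rewrite mul0r mulrBr; apply/eqP.
  by rewrite subr_eq0 -bc -ab ac.
have b0 : b = 0 by apply: (mulIf k2_neq0); rewrite bc c0 !mul0r.
have a0 : a = 0 by apply: (mulIf k1_neq0); rewrite ac c0 !mul0r.
have two0 : 2%:R != 0 :> R[i] by rewrite pnatr_eq0.
have d0 : d = 0.
  apply: (mulfI (mulf_neq0 two0 k2_neq0)); rewrite mulr0.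
  by apply: eq_of_combination (combination_cons (-1) e6 erefl) _;
    rewrite a0 b0; ring.
have e0 : e = 0.
  apply: (mulfI (mulf_neq0 two0 k2_neq0)); rewrite mulr0.
  by apply: eq_of_combination (combination_cons (-1) e2 erefl) _;
    rewrite a0 c0; ring.
have f0 : f = 0.
  apply: (mulfI (mulf_neq0 two0 k1_neq0)); rewrite mulr0.
  by apply: eq_of_combination (combination_cons (-1) e3 erefl) _;
    rewrite b0 c0; ring.
by rewrite a0 b0 c0 d0 e0 f0 symmx0 nonunit_mx0.
Qed.

End TriplePoints.

(** * Conics in the cases [k2 = k1] and [k2 = - k1] *)

Section OneParameter.
Variable k : R[i].
Hypothesis k_neq0 : k != 0.

Lemma conic_triple_points_exists gamma : k ^+ 3 != 1 ->
  exists Q, smooth_conic Q /\ forall s, s \in triple_labels ->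
    exists2 p, meet_at (M gamma k k) s p & on_conic Q p.
Proof.
rewrite -subr_eq0 => k3; pose t := k + k^-1.
have k1 : k - 1 != 0 by apply: contraNneq k3 => k1; rewrite subrX1 k1 mul0r.
(* On each axis the form restricts to [2 (u^2 + t u v + v^2) = 2 (u + k v) (u + k^-1 v)], whose
   zeros are the two prescribed points. *)
exists (symmx 2%:R 2%:R 2%:R t t t); split.
  apply/smooth_conicP; split; first exact: tr_symmx.
  apply: unitmx_symmx.
  set D := (X in X != 0).
  have -> : D = 2%:R * (k - 1) ^+ 3 * (k ^+ 3 - 1) / k ^+ 3.
    by rewrite /D /t; field.
  by rewrite !mulf_neq0 ?invr_eq0 ?expf_neq0 ?pnatr_eq0.
move=> s hs.
suff [v sv vQ] : exists2 v, (s, v) \in triple_points k k &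
    on_conic (symmx 2%:R 2%:R 2%:R t t t) v^T.
  by apply/(meet_on_conicP _ k_neq0 k_neq0 _ sv).
move: hs; rewrite !inE => hs; do 5?case/orP: hs => hs; rewrite {s hs}(eqP hs).
- exists (line 1 0 (- k^-1)); first exact: (@mem_triple _ _ 0).
  by rewrite /on_conic trmxK symmx_formE /t; apply/eqP; field.
- exists (line 1 0 (- k)); first exact: (@mem_triple _ _ 1).
  by rewrite /on_conic trmxK symmx_formE /t; apply/eqP; field.
- exists (line 0 1 (- k)); first exact: (@mem_triple _ _ 2).
  by rewrite /on_conic trmxK symmx_formE /t; apply/eqP; field.
- exists (line 0 1 (- k^-1)); first exact: (@mem_triple _ _ 3).
  by rewrite /on_conic trmxK symmx_formE /t; apply/eqP; field.
- exists (line k (-1) 0); first exact: (@mem_triple _ _ 4).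
  by rewrite /on_conic trmxK symmx_formE /t; apply/eqP; field.
- exists (line 1 (- k) 0); first exact: (@mem_triple _ _ 5).
  by rewrite /on_conic trmxK symmx_formE /t; apply/eqP; field.
Qed.

Definition tangent_labels := [:: 6; 7; 8; 10; 11; 13]%N.

(** The hypotheses make every factor of the determinant of the dual conic [S] nonzero. *)
Lemma tangent_conic_exists :
    k ^+ 2 != 1 -> k ^+ 2 != -1 -> k ^+ 3 + 2%:R * k ^+ 2 + k + 1 != 0 ->
  exists Q, smooth_conic Q /\ forall i, i \in labels tangent_labels ->
    tangent_to_conic Q (M (k ^+ 2) k k i).
Proof.
rewrite -subr_eq0 -(subr_eq0 _ (-1)) opprK => k2 k2' k3.
have k1 : k - 1 != 0 by apply: contraNneq k2 => k1; rewrite subrX1 k1 mul0r.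
(* The dual points of the six lines come in three pairs exchanged by swapping
   the first two coordinates, so a dual conic with the same symmetry has only
   three conditions to meet. *)
pose S := symmx 2%:R 2%:R (2%:R * (k + k^-1)) (1 - k ^+ 2)
  (- (1 + k^-1)) (- (1 + k^-1)).
have uS : S \in unitmx.
  apply: unitmx_symmx; set D := (X in X != 0).
  have -> : D = - 2%:R * (k ^+ 2 + 1) * (k - 1) ^+ 2
                  * (k ^+ 3 + 2%:R * k ^+ 2 + k + 1) / k ^+ 2.
    by rewrite /D; field.
  by rewrite !mulf_neq0 ?invr_eq0 ?expf_neq0 ?oppr_eq0 ?pnatr_eq0.
have smQ : smooth_conic (invmx S).
  by apply/smooth_conicP; rewrite unitmx_inv trmx_inv tr_symmx.
exists (invmx S); split=> // -[m hm]; rewrite inE /= !inE => hi.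
do 5?case/orP: hi => hi; case/eqP: hi => hi; subst m;
  (apply/tangent_to_conicP => //; rewrite /M /=;
    [by rewrite line_eq0 oner_eq0 !andbF
    |by rewrite invmxK symmx_formE; apply/eqP; field]).
Qed.

(** The six tangency conditions are linear in the six coefficients of the dual conic; for such [k]
    their only solution is zero, which is not invertible. *)
Lemma tangent_conic_opp Q :
    k ^+ 2 != 1 -> k ^+ 2 != -1 -> k ^+ 3 != 1 -> k ^+ 3 != -1 ->
    smooth_conic Q ->
  ~ forall i, i \in labels tangent_labels ->
    tangent_to_conic Q (M (k ^+ 2) k (- k) i).
Proof.
rewrite -subr_eq0 -(subr_eq0 _ (-1)) -(subr_eq0 (k ^+ 3)).
rewrite -(subr_eq0 (k ^+ 3) (-1)) !opprK => k2 k2' k3 k3' smQ tQ.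
have k1 : k - 1 != 0 by apply: contraNneq k2 => k1; rewrite subrX1 k1 mul0r.
have k1' : k + 1 != 0.
  apply: contraNneq k2 => k1'; have -> : k ^+ 2 - 1 = (k - 1) * (k + 1) by ring.
  by rewrite k1' mulr0.
have [symQ uQ] := (smooth_conicP Q).1 smQ.
have uS : invmx Q \in unitmx by rewrite unitmx_inv.
have symS : (invmx Q)^T = invmx Q by rewrite trmx_inv symQ.
have [a [b [c [d [e [f eS]]]]]] := symmxP symS.
have onS i x y : i \in labels tangent_labels ->
    M (k ^+ 2) k (- k) i = line x y 1 ->
    a * x ^+ 2 + b * y ^+ 2 + c * 1 ^+ 2
      + 2%:R * (d * x * y + e * x * 1 + f * y * 1) = 0.
  move=> /tQ + Mi; rewrite {}Mi => /tangent_to_conicP; rewrite eS.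
  rewrite symmx_formE line_eq0 oner_eq0 !andbF => /(_ smQ isT).
  by move/eqP.
have memL j (j13 : (j < 13)%N) :
  j.+1 \in tangent_labels -> Ordinal j13 \in labels tangent_labels.
  by move=> jt; rewrite inE.
have e6 : _ = 0 := onS (lab 6) 1 (k ^+ 2) (@memL 5 isT isT) erefl.
have e7 : _ = 0 := onS (lab 7) (k ^+ 2) 1 (@memL 6 isT isT) erefl.
have e8 : _ = 0 := onS (lab 8) k^-1 k (@memL 7 isT isT) erefl.
have e10 : _ = 0 := onS (lab 10) k^-1 1 (@memL 9 isT isT) erefl.
have e11 : _ = 0 := onS (lab 11) (- k) (- k)^-1 (@memL 10 isT isT) erefl.
have e13 : _ = 0 := onS (lab 13) 1 (- k)^-1 (@memL 12 isT isT) erefl.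
rewrite invrN in e11 e13.
(* Each line joining two of the six dual points cuts the dual conic in a
   quadratic equation with known roots; [r1]--[r6] are the resulting linear
   relations between the coefficients. *)
have r1 : b * (k ^+ 2 - k^-1) + 2%:R * d + 2%:R * f = 0.
  apply: (mulfI k3'); rewrite mulr0.
  by apply: eq_of_combination (combination_cons k e6
      (combination_cons (- k) e13 erefl)) _; field.
have r2 : b * (k + 1) + 2%:R * d / k + 2%:R * f = 0.
  apply: (mulfI k1); rewrite mulr0.
  by apply: eq_of_combination (combination_cons 1 e8
      (combination_cons (-1) e10 erefl)) _; field.
have r3 : a * (k ^+ 2 + k^-1) + 2%:R * d + 2%:R * e = 0.
  apply: (mulfI k3); rewrite mulr0.
  by apply: eq_of_combination (combination_cons k e7
      (combination_cons (- k) e10 erefl)) _; field.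
have r4 : a * (1 - k) - 2%:R * d / k + 2%:R * e = 0.
  apply: (mulfI k1'); rewrite mulr0.
  by apply: eq_of_combination (combination_cons (-1) e11
      (combination_cons 1 e13 erefl)) _; field.
have r5 : a / k + b * k ^+ 3 + 2%:R * d * k - c = 0.
  apply: (mulfI k1); rewrite mulr0.
  by apply: eq_of_combination (combination_cons 1 e6
      (combination_cons (- k) e8 erefl)) _; field.
have r6 : a * k ^+ 3 + b / k + 2%:R * d * k + c = 0.
  apply: (mulfI k1'); rewrite mulr0.
  by apply: eq_of_combination (combination_cons 1 e7
      (combination_cons k e11 erefl)) _; field.
(* Eliminating [f], [e] and [c] in turn from the pairs of relations leaves [s1], [s2], [s3], a
   linear system in [a], [b] and [2 d]. *)
pose X := k ^+ 3 - k ^+ 2 - k - 1; pose Y := k ^+ 3 + k ^+ 2 - k + 1.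
pose Z := k ^+ 4 + 1.
have s1 : b * X + 2%:R * d * (k - 1) = 0.
  by apply: eq_of_combination (combination_cons k r1
      (combination_cons (- k) r2 erefl)) _; rewrite /X; field.
have s2 : a * Y + 2%:R * d * (k + 1) = 0.
  by apply: eq_of_combination (combination_cons k r3
      (combination_cons (- k) r4 erefl)) _; rewrite /Y; field.
have s3 : (a + b) * Z + 2%:R * (2%:R * d) * k ^+ 2 = 0.
  by apply: eq_of_combination (combination_cons k r5
      (combination_cons k r6 erefl)) _; rewrite /Z; field.
have two0 : 2%:R != 0 :> R[i] by rewrite pnatr_eq0.
(* This is the determinant of that system; the combinations giving [d0], [a0] and [b0] use its
   cofactors, as in Cramer's rule. *)
have det0 : 2%:R * (k ^+ 2 + 1) ^+ 2 * (k ^+ 2 - 1) != 0.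
  by rewrite !mulf_neq0 ?expf_neq0.
have d0 : d = 0.
  apply: (mulfI (mulf_neq0 two0 det0)); rewrite mulr0.
  by apply: eq_of_combination (combination_cons (- (X * Y)) s3
      (combination_cons (Z * Y) s1 (combination_cons (Z * X) s2 erefl))) _;
    rewrite /X /Y /Z; ring.
have a0 : a = 0.
  apply: (mulfI det0); rewrite mulr0.
  by apply: eq_of_combination (combination_cons (X * (k + 1)) s3
      (combination_cons (- (k + 1) * Z) s1
      (combination_cons (- (X * (2%:R * k ^+ 2) - (k - 1) * Z)) s2 erefl))) _;
    rewrite /X /Y /Z; ring.
have b0 : b = 0.
  apply: (mulfI det0); rewrite mulr0.
  by apply: eq_of_combination (combination_cons ((k - 1) * Y) s3
      (combination_cons (- (Y * (2%:R * k ^+ 2) - (k + 1) * Z)) s1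
      (combination_cons (- (k - 1) * Z) s2 erefl))) _;
    rewrite /X /Y /Z; ring.
have c0 : c = 0.
  by apply: eq_of_combination (combination_cons (-1) r5 erefl) _;
    rewrite a0 b0 d0; ring.
have e0 : e = 0.
  apply: (mulfI two0); rewrite mulr0.
  by apply: eq_of_combination (combination_cons 1 r3 erefl) _;
    rewrite a0 d0; ring.
have f0 : f = 0.
  apply: (mulfI two0); rewrite mulr0.
  by apply: eq_of_combination (combination_cons 1 r1 erefl) _;
    rewrite b0 d0; ring.
by move: uS; rewrite eS a0 b0 c0 d0 e0 f0 symmx0 (negPf (nonunit_mx0 _)).
Qed.

End OneParameter.
End Realization.

(** * Parameter values excluded by the distinctness of the lines and by the combinatorics *)

Section Genericity.
Variables (R : realType) (gamma k1 k2 : R[i]).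
Hypothesis M_Sigma2 : Sigma2 (M gamma k1 k2).

Lemma Sigma2_gamma_neq1 : gamma != 1.
Proof.
have := @Sigma2_neq _ _ (lab 4) (lab 5) M_Sigma2 isT.
by apply: contra_neq => e; rewrite /M /= e.
Qed.

Lemma Sigma2_k1k2_neq1 : k1 != 0 -> k1 * k2 != 1.
Proof.
move=> k1_neq0; have := @Sigma2_neq _ _ (lab 10) (lab 12) M_Sigma2 isT.
apply: contra_neq => e; rewrite /M /=; congr line.
by apply: (mulfI k1_neq0); rewrite e mulfV.
Qed.

Lemma Sigma2_gamma_k1_neq1 : k1 != 0 -> gamma * k1 != 1.
Proof.
move=> k1_neq0; have := @Sigma2_neq _ _ (lab 7) (lab 10) M_Sigma2 isT.
apply: contra_neq => e; rewrite /M /=; congr line.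
by apply: (mulIf k1_neq0); rewrite e mulVf.
Qed.

Lemma Sigma2_gamma_k2_neq1 : k2 != 0 -> gamma * k2 != 1.
Proof.
move=> k2_neq0; have := @Sigma2_neq _ _ (lab 6) (lab 13) M_Sigma2 isT.
apply: contra_neq => e; rewrite /M /=; congr line.
by apply: (mulIf k2_neq0); rewrite e mulVf.
Qed.

End Genericity.

(* Otherwise [L_6], [L_7] and [L_8] meet at [1 : 1 : 0]. *)
Lemma Sigma2_sqr_neqN1 (R : realType) (k : R[i]) :
  k != 0 -> Sigma2 (M (k ^+ 2) k k) -> k ^+ 2 != -1.
Proof.
move=> k0 M_Sigma2; apply/eqP => k2.
suff : ~~ has (fun J : {set 'I_13} => [&& lab 6 \in J, lab 7 \in J
         & lab 8 \in J]) combinatorics2.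
  move/negP; apply.
  apply: (@Sigma2_concurrent3 _ _ _ _ _ (line 1 1 0)^T M_Sigma2) => //.
  - by rewrite tr_line_eq0 oner_eq0.
  - by rewrite /M /= on_lineE k2; apply/eqP; ring.
  - by rewrite /M /= on_lineE k2; apply/eqP; ring.
  - rewrite /M /= on_lineE; apply/eqP; apply: (mulfI k0); rewrite mulr0.
    have k2' : k ^+ 2 + 1 = 0 by rewrite k2 addNr.
    by apply: eq_of_combination (combination_cons 1 k2' erefl) _; field.
by rewrite /= !inE.
Qed.

(* Otherwise [L_6], [L_10] and [L_11] meet at [-k (k + 1) : 1 : k]. *)
Lemma Sigma2_cubic_neq0 (R : realType) (k : R[i]) : k != 0 ->
  Sigma2 (M (k ^+ 2) k k) -> k ^+ 3 + 2%:R * k ^+ 2 + k + 1 != 0.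
Proof.
move=> k0 M_Sigma2; apply/eqP => k3.
suff : ~~ has (fun J : {set 'I_13} => [&& lab 6 \in J, lab 10 \in J
         & lab 11 \in J]) combinatorics2.
  move/negP; apply.
  apply: (@Sigma2_concurrent3 _ _ _ _ _ (line (- k * (k + 1)) 1 k)^T M_Sigma2).
  - by [].
  - by rewrite tr_line_eq0 oner_eq0 andbF.
  - by rewrite /M /= on_lineE; apply/eqP; ring.
  - by rewrite /M /= on_lineE; apply/eqP; field.
  - rewrite /M /= on_lineE; apply/eqP; apply: (mulfI k0); rewrite mulr0.
    by apply: eq_of_combination (combination_cons (1 - k) k3 erefl) _; field.
by rewrite /= !inE.
Qed.

Theorem proposition4p6 (R : realType) (gamma k1 k2 : R[i])
    (gamma_neq0 : gamma != 0) (k1_neq0 : k1 != 0) (k2_neq0 : k2 != 0)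
    (k1_sqr : k1 ^+ 2 = gamma) (k2_sqr : k2 ^+ 2 = gamma)
    (M_Sigma2 : Sigma2 (M gamma k1 k2)) :
  [<-> (* 1 *)
       Sigma20 (M gamma k1 k2);
       (* 2 *)
       exists Q : 'M[R[i]]_3, smooth_conic Q /\
         forall i, i \in labels [:: 6; 7; 8; 10; 11; 13]%N ->
           tangent_to_conic Q (M gamma k1 k2 i);
       (* 3 *)
       exists Q : 'M[R[i]]_3, smooth_conic Q /\
         forall s, s \in [:: [:: 1; 8; 10]; [:: 1; 11; 12]; [:: 2; 8; 9];
                             [:: 2; 11; 13]; [:: 3; 9; 10];
                             [:: 3; 12; 13]]%N ->
           exists2 p, meet_at (M gamma k1 k2) s p & on_conic Q p;
       (* 4 *)
       exists l : 'rV[R[i]]_3, l != 0 /\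
         forall s, s \in [:: [:: 1; 11; 12]; [:: 2; 8; 9]; [:: 3; 4; 5]]%N ->
           exists2 p, meet_at (M gamma k1 k2) s p & on_line l p].
Proof.
have neq1 := Sigma2_gamma_neq1 M_Sigma2.
have k12_neq1 := Sigma2_k1k2_neq1 M_Sigma2 k1_neq0.
have gk1_neq1 := Sigma2_gamma_k1_neq1 M_Sigma2 k1_neq0.
have gk2_neq1 := Sigma2_gamma_k2_neq1 M_Sigma2 k2_neq0.
tfae.
- case=> gamma' [k [gamma'_neq0 k_neq0 _ _ equivM]].
  have k12 : k1 = k2.
    (* Alignment holds in [M gamma' k k] and passes to [M gamma k1 k2] by projective equivalence. *)
    apply/(aligned_triple_pointsP gamma k1_neq0 k2_neq0).
    by apply: proj_equiv_aligned equivM _; apply/aligned_triple_pointsP.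
  rewrite -{}k12 -{}k1_sqr in M_Sigma2 neq1 *.
  apply: tangent_conic_exists => //; first exact: Sigma2_sqr_neqN1.
  exact: Sigma2_cubic_neq0.
- case=> Q [smQ tQ]; have k12 : k1 = k2.
    have /eqP : k2 ^+ 2 = k1 ^+ 2 by rewrite k1_sqr.
    rewrite eqf_sqr => /orP[/eqP-> // | /eqP k2E].
    (* With [k2 = - k1], the four genericity conditions say that [k1 ^+ 2] and [k1 ^+ 3] differ from
       1 and -1. *)
    rewrite k2E -k1_sqr in tQ neq1 k12_neq1 gk1_neq1 gk2_neq1.
    case: (tangent_conic_opp k1_neq0 _ _ _ _ smQ tQ) => //.
    + by apply: contra_neq k12_neq1 => k1E; rewrite mulrN -expr2 k1E opprK.
    + by rewrite exprSr.
    + by apply: contra_neq gk2_neq1 => k1E; rewrite mulrN -exprSr k1E opprK.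
  rewrite -k12; apply: conic_triple_points_exists => //.
  by rewrite exprSr k1_sqr.
- case=> Q [smQ tQ]; apply/(aligned_triple_pointsP gamma k1_neq0 k2_neq0).
  exact: conic_triple_points_eq tQ.
- move/(aligned_triple_pointsP gamma k1_neq0 k2_neq0) => k12.
  exists gamma, k1.
  split; [by [] | by [] | by [] | by rewrite {2}k12 | ].
  exists 1%:M; first exact: unitmx1.
  move=> i; exists 1; first exact: oner_neq0.
  by rewrite mulmx1 scale1r -k12.
Qed.
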